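(* Let $D_0=D_1\times_e D_2$, where $D_1$ and $D_2$ are open domains in $\mathbb{C}(\mathbf{i}_1)$. Let $(F,G)$ be the $\mathbf{j}^*$-generating pair in $D_0$ determined by complex generating pairs $(F_{e_1},G_{e_1})$ in $D_1$ and $(F_{e_2},G_{e_2})$ in $D_2$, and let $w:D_0\to\mathbb{T}$ be an $(F,G)_{\mathbf{j}}$-pseudoanalytic function on $D_0$. Then $$w(z_1+z_2\mathbf{i}_2)=w_{e_1}(z_1-z_2\mathbf{i}_1)\,\mathbf{e}_1+w_{e_2}(z_1+z_2\mathbf{i}_1)\,\mathbf{e}_2\qquad\text{on }D_0,$$ where $w_{e_k}:D_k\to\mathbb{C}(\mathbf{i}_1)$ is an $(F_{e_k},G_{e_k})$-pseudoanalytic function on $D_k$ for $k=1,2$. Moreover, $$\dot w(z_1+z_2\mathbf{i}_2)=\dot w_{e_1}(z_1-z_2\mathbf{i}_1)\,\mathbf{e}_1+\dot w_{e_2}(z_1+z_2\mathbf{i}_1)\,\mathbf{e}_2\qquad\text{on }D_0,$$ where $\dot w$ is the $(F,G)_{\mathbf{j}}$-derivative and $\dot w_{e_k}$ is the $(F_{e_k},G_{e_k})$-derivative.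
   Context: **Bicomplex numbers.** $\mathbb{T}=\{w_0+w_1\mathbf{i}_1+w_2\mathbf{i}_2+w_3\mathbf{j}: w_i\in\mathbb{R}\}$ is the commutative real algebra with $\mathbf{i}_1^2=\mathbf{i}_2^2=-1$, $\mathbf{j}^2=1$, $\mathbf{i}_1\mathbf{i}_2=\mathbf{i}_2\mathbf{i}_1=\mathbf{j}$. $\mathbb{C}(\mathbf{i}_1)=\{x+y\mathbf{i}_1\}$ and $\mathbb{D}=\{x+y\mathbf{j}\}$ ($x,y\in\mathbb{R}$). Every $\omega\in\mathbb{T}$ is uniquely $\omega=z_1+z_2\mathbf{i}_2$ with $z_1,z_2\in\mathbb{C}(\mathbf{i}_1)$. Conjugations: $\omega^{\dagger_1}=\overline{z}_1+\overline{z}_2\mathbf{i}_2$, $\omega^{\dagger_2}=z_1-z_2\mathbf{i}_2$, $\omega^{\dagger_3}=\overline{z}_1-\overline{z}_2\mathbf{i}_2$. With $\mathbf{e}_1=\frac{1+\mathbf{j}}2$, $\mathbf{e}_2=\frac{1-\mathbf{j}}2$ one has uniquely $z_1+z_2\mathbf{i}_2=(z_1-z_2\mathbf{i}_1)\mathbf{e}_1+(z_1+z_2\mathbf{i}_1)\mathbf{e}_2$. For $D_1,D_2\subset\mathbb{C}(\mathbf{i}_1)$, $D_1\times_e D_2=\{\zeta_1\mathbf{e}_1+\zeta_2\mathbf{e}_2:\zeta_1\in D_1,\zeta_2\in D_2\}$. **Operators.** With $z_k=x_k+y_k\mathbf{i}_1$, $\partial_{z_k}=\frac12(\partial_{x_k}-\mathbf{i}_1\partial_{y_k})$,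 $\partial_{\bar z_k}=\frac12(\partial_{x_k}+\mathbf{i}_1\partial_{y_k})$: $\partial_{\omega^{\dagger_1}}=\frac12(\partial_{\bar z_1}-\mathbf{i}_2\partial_{\bar z_2})$, $\partial_{\omega^{\dagger_2}}=\frac12(\partial_{z_1}+\mathbf{i}_2\partial_{z_2})$, $\partial_{\omega^{\dagger_3}}=\frac12(\partial_{\bar z_1}+\mathbf{i}_2\partial_{\bar z_2})$. Subscripts denote application of these operators. **Complex pairs.** A complex generating pair in an open set $D\subset\mathbb{C}(\mathbf{i}_1)$ is a pair of twice continuously differentiable functions $F,G:D\to\mathbb{C}(\mathbf{i}_1)$ with $\mathrm{Im}(\overline{F}G)\neq0$ on $D$. A function $w:D\to\mathbb{C}(\mathbf{i}_1)$ is $(F,G)$-pseudoanalytic if it is continuously differentiable and satisfies the Vekua equation $w_{\bar z}=a\,w+b\,\overline{w}$ with $a=-\frac{\overline{F}G_{\bar z}-F_{\bar z}\overline{G}}{F\overline{G}-\overline{F}G}$, $b=\frac{FG_{\bar z}-F_{\bar z}G}{F\overline{G}-\overline{F}G}$. Its $(F,G)$-derivative at $\zeta_0$ is $\dot w(\zeta_0)=\lim_{\zeta\to\zeta_0}\frac{w(\zeta)-\lambda_0F(\zeta)-\mu_0G(\zeta)}{\zeta-\zeta_0}$, where $\lambda_0,\mu_0\in\mathbb{R}$ are the unique constants with $w(\zeta_0)=\lambda_0F(\zeta_0)+\mu_0G(\zeta_0)$. **Bicomplex pairs.** Given complex generating pairs $(F_{e_k},G_{e_k})$ in open $D_k$ ($k=1,2$),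 the $\mathbf{j}^*$-generating pair they determine in $D_0=D_1\times_eD_2$ is $F(z_1+z_2\mathbf{i}_2)=F_{e_1}(z_1-z_2\mathbf{i}_1)\mathbf{e}_1+F_{e_2}(z_1+z_2\mathbf{i}_1)\mathbf{e}_2$, $G(z_1+z_2\mathbf{i}_2)=G_{e_1}(z_1-z_2\mathbf{i}_1)\mathbf{e}_1+G_{e_2}(z_1+z_2\mathbf{i}_1)\mathbf{e}_2$. A function $w:D_0\to\mathbb{T}$ is $(F,G)_{\mathbf{j}}$-pseudoanalytic if it has continuous first partial derivatives and satisfies the three $\mathbf{j}$-bicomplex Vekua equations $w_{\omega^{\dagger_k}}=a^{(k)}w+b^{(k)}w^{\dagger_3}$, $k=1,2,3$, with $$a^{(k)}=-\frac{F^{\dagger_k}G_{\omega^{\dagger_k}}-F_{\omega^{\dagger_k}}G^{\dagger_k}}{FG^{\dagger_3}-F^{\dagger_3}G},\qquad b^{(k)}=\frac{FG_{\omega^{\dagger_k}}-F_{\omega^{\dagger_k}}G}{FG^{\dagger_3}-F^{\dagger_3}G}.$$ Its $(F,G)_{\mathbf{j}}$-derivative at $\omega_0$ is $\dot w(\omega_0)=\lim\frac{w(\omega)-\lambda_0F(\omega)-\mu_0G(\omega)}{\omega-\omega_0}$ as $\omega\to\omega_0$ with $\omega-\omega_0$ invertible, where $\lambda_0,\mu_0\in\mathbb{D}$ are the unique constants with $w(\omega_0)=\lambda_0F(\omega_0)+\mu_0G(\omega_0)$. *)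

(* Defs.v *)
(* Stdlib reals with Coquelicot. *)
From Stdlib Require Import Reals Lra.
From Coquelicot Require Import Coquelicot.

Open Scope R_scope.

(** Functions on a subset of [C] or [BC] are total functions; every notion below
    refers to them only through their values near points of an open set, so the
    values outside the open set are irrelevant. *)

(** * Bicomplex algebra *)

(** [(z1, z2)] stands for [z1 + z2 i2]; since [i1 i2 = j], the real coordinates
    [w0, w1, w2, w3] of the bicomplex number are [((w0, w1), (w2, w3))]. *)
Definition BC : Set := (C * C)%type.

Declare Scope BC_scope.
Delimit Scope BC_scope with BC.
Bind Scope BC_scope with BC.

Definition BC_of_C (z : C) : BC := (z, RtoC 0).
Definition i1 : BC := BC_of_C Ci.
Definition i2 : BC := (RtoC 0, RtoC 1).
Definition j : BC := (RtoC 0, Ci).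

Definition BCplus (a b : BC) : BC := (fst a + fst b, snd a + snd b)%C.
Definition BCopp (a : BC) : BC := (- fst a, - snd a)%C.
Definition BCminus (a b : BC) : BC := BCplus a (BCopp b).
Definition BCmult (a b : BC) : BC :=
  (fst a * fst b - snd a * snd b, fst a * snd b + snd a * fst b)%C.

Definition invertible (a : BC) : Prop := exists b : BC, BCmult a b = BC_of_C 1.

(** [1 / (z1 + z2 i2) = (z1 - z2 i2) / (z1^2 + z2^2)]; meaningful only for
    invertible arguments, see [BCinv_r]. *)
Definition BCinv (a : BC) : BC :=
  let n := (fst a * fst a + snd a * snd a)%C in (fst a / n, - snd a / n)%C.
Definition BCdiv (a b : BC) : BC := BCmult a (BCinv b).

Infix "+" := BCplus : BC_scope.
Infix "-" := BCminus : BC_scope.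
Infix "*" := BCmult : BC_scope.
Infix "/" := BCdiv : BC_scope.
Notation "- a" := (BCopp a) : BC_scope.

Definition e1 : BC := (BC_of_C (/ 2) * (BC_of_C 1 + j))%BC.
Definition e2 : BC := (BC_of_C (/ 2) * (BC_of_C 1 - j))%BC.

Lemma BCinv_r (a : BC) : invertible a -> (a * BCinv a)%BC = BC_of_C 1.
Proof.
destruct a as [z1 z2]; intros [[u1 u2] H].
unfold BCmult, BC_of_C in H; simpl in H.
assert (H1 : (z1 * u1 - z2 * u2 = 1)%C) by exact (f_equal fst H).
assert (H2 : (z1 * u2 + z2 * u1 = 0)%C) by exact (f_equal snd H).
assert (Hn : (z1 * z1 + z2 * z2 <> 0)%C).
{ intros Hn; apply C1_nz.
  transitivity ((z1 * u1 - z2 * u2) * (z1 * u1 - z2 * u2)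
                + (z1 * u2 + z2 * u1) * (z1 * u2 + z2 * u1))%C.
  - rewrite H1, H2; ring.
  - transitivity ((z1 * z1 + z2 * z2) * (u1 * u1 + u2 * u2))%C; [ring|].
    rewrite Hn; ring. }
unfold BCmult, BCinv, BC_of_C; simpl; f_equal; field; exact Hn.
Qed.

Lemma idempotent_representation (z1 z2 : C) :
  (BC_of_C z1 + BC_of_C z2 * i2)%BC
  = (BC_of_C (z1 - z2 * Ci)%C * e1 + BC_of_C (z1 + z2 * Ci)%C * e2)%BC.
Proof.
destruct z1 as [x1 y1], z2 as [x2 y2].
assert (H2 : (/ RtoC 2)%C = RtoC (/ 2)) by (symmetry; apply RtoC_inv; lra).
unfold e1, e2; rewrite H2.
cbv [BCplus BCminus BCopp BCmult BC_of_C i2 j fst snd Cplus Cminus Copp Cmult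
     Ci RtoC].
f_equal; f_equal; field.
Qed.

(** [D1 x_e D2] *)
Definition prod_e (D1 D2 : C -> Prop) (w : BC) : Prop :=
  exists s1 s2 : C, D1 s1 /\ D2 s2 /\ w = (BC_of_C s1 * e1 + BC_of_C s2 * e2)%BC.

(** The subalgebra [D] of the numbers [x + y j] with [x], [y] real. *)
Definition hyperbolic (a : BC) : Prop :=
  exists x y : R, a = (BC_of_C (RtoC x) + BC_of_C (RtoC y) * j)%BC.

Inductive dagger_index : Set := dag1 | dag2 | dag3.

Definition dagger (k : dagger_index) (a : BC) : BC :=
  match k with
  | dag1 => (Cconj (fst a), Cconj (snd a))
  | dag2 => (fst a, (- snd a)%C)
  | dag3 => (Cconj (fst a), (- Cconj (snd a))%C)
  end.

(** * Complex derivatives and generating pairs *)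

Definition connected (D : C -> Prop) : Prop :=
  forall U V : C -> Prop, open U -> open V ->
    (forall z, D z -> U z \/ V z) ->
    (exists z, D z /\ U z) -> (exists z, D z /\ V z) ->
    exists z, D z /\ U z /\ V z.

Definition open_domain (D : C -> Prop) : Prop := open D /\ connected D.

(** Derivative of a complex-valued function of one real variable. *)
Definition C_Derive (f : R -> C) (t : R) : C :=
  (Derive (fun s => Re (f s)) t, Derive (fun s => Im (f s)) t).

Definition d_x (f : C -> C) (z : C) : C := C_Derive (fun t => f (t, Im z)) (Re z).
Definition d_y (f : C -> C) (z : C) : C := C_Derive (fun t => f (Re z, t)) (Im z).

Definition C1_on (D : C -> Prop) (f : C -> C) : Prop :=
  forall z : C, D z ->
    ex_derive (V := C_R_NormedModule) (fun t => f (t, Im z)) (Re z) /\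
    ex_derive (V := C_R_NormedModule) (fun t => f (Re z, t)) (Im z) /\
    continuous (d_x f) z /\ continuous (d_y f) z.

Definition C2_on (D : C -> Prop) (f : C -> C) : Prop :=
  C1_on D f /\ C1_on D (d_x f) /\ C1_on D (d_y f).

Definition d_zbar (f : C -> C) (z : C) : C := (/ 2 * (d_x f z + Ci * d_y f z))%C.

Definition generating_pair (D : C -> Prop) (F G : C -> C) : Prop :=
  C2_on D F /\ C2_on D G /\ forall z : C, D z -> Im (Cconj (F z) * G z)%C <> 0.

Definition vekua_a (F G : C -> C) (z : C) : C :=
  (- ((Cconj (F z) * d_zbar G z - d_zbar F z * Cconj (G z))
      / (F z * Cconj (G z) - Cconj (F z) * G z)))%C.
Definition vekua_b (F G : C -> C) (z : C) : C :=
  ((F z * d_zbar G z - d_zbar F z * G z)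
   / (F z * Cconj (G z) - Cconj (F z) * G z))%C.

Definition pseudoanalytic (D : C -> Prop) (F G w : C -> C) : Prop :=
  C1_on D w /\
  forall z : C, D z ->
    d_zbar w z = (vekua_a F G z * w z + vekua_b F G z * Cconj (w z))%C.

(** [d] is the [(F,G)]-derivative of [w] at [z0]. *)
Definition is_FG_derivative (F G w : C -> C) (z0 d : C) : Prop :=
  exists l m : R,
    w z0 = (RtoC l * F z0 + RtoC m * G z0)%C /\
    filterlim (fun z : C => ((w z - RtoC l * F z - RtoC m * G z) / (z - z0))%C)
      (locally' z0) (locally d).

(** * Bicomplex derivatives and generating pairs *)

Definition BC_R_NormedModule : NormedModule R_AbsRing :=
  prod_NormedModule R_AbsRing C_R_NormedModule C_R_NormedModule.

Definition BC_Derive (f : R -> BC) (t : R) : BC :=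
  (C_Derive (fun s => fst (f s)) t, C_Derive (fun s => snd (f s)) t).

(** Restrictions of [f] to the coordinate lines through [a]. *)
Definition line_x1 (f : BC -> BC) (a : BC) (t : R) : BC := f ((t, Im (fst a)), snd a).
Definition line_y1 (f : BC -> BC) (a : BC) (t : R) : BC := f ((Re (fst a), t), snd a).
Definition line_x2 (f : BC -> BC) (a : BC) (t : R) : BC := f (fst a, (t, Im (snd a))).
Definition line_y2 (f : BC -> BC) (a : BC) (t : R) : BC := f (fst a, (Re (snd a), t)).

Definition d_x1 (f : BC -> BC) (a : BC) : BC := BC_Derive (line_x1 f a) (Re (fst a)).
Definition d_y1 (f : BC -> BC) (a : BC) : BC := BC_Derive (line_y1 f a) (Im (fst a)).
Definition d_x2 (f : BC -> BC) (a : BC) : BC := BC_Derive (line_x2 f a) (Re (snd a)).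
Definition d_y2 (f : BC -> BC) (a : BC) : BC := BC_Derive (line_y2 f a) (Im (snd a)).

Definition BC_C1_on (D : BC -> Prop) (f : BC -> BC) : Prop :=
  forall a : BC, D a ->
    (ex_derive (V := BC_R_NormedModule) (line_x1 f a) (Re (fst a)) /\
     ex_derive (V := BC_R_NormedModule) (line_y1 f a) (Im (fst a)) /\
     ex_derive (V := BC_R_NormedModule) (line_x2 f a) (Re (snd a)) /\
     ex_derive (V := BC_R_NormedModule) (line_y2 f a) (Im (snd a))) /\
    (continuous (d_x1 f) a /\ continuous (d_y1 f) a /\
     continuous (d_x2 f) a /\ continuous (d_y2 f) a).

Definition d_z1 (f : BC -> BC) (a : BC) : BC :=
  (BC_of_C (/ 2) * (d_x1 f a - i1 * d_y1 f a))%BC.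
Definition d_z2 (f : BC -> BC) (a : BC) : BC :=
  (BC_of_C (/ 2) * (d_x2 f a - i1 * d_y2 f a))%BC.
Definition d_z1bar (f : BC -> BC) (a : BC) : BC :=
  (BC_of_C (/ 2) * (d_x1 f a + i1 * d_y1 f a))%BC.
Definition d_z2bar (f : BC -> BC) (a : BC) : BC :=
  (BC_of_C (/ 2) * (d_x2 f a + i1 * d_y2 f a))%BC.

Definition d_dagger (k : dagger_index) (f : BC -> BC) (a : BC) : BC :=
  match k with
  | dag1 => (BC_of_C (/ 2) * (d_z1bar f a - i2 * d_z2bar f a))%BC
  | dag2 => (BC_of_C (/ 2) * (d_z1 f a + i2 * d_z2 f a))%BC
  | dag3 => (BC_of_C (/ 2) * (d_z1bar f a + i2 * d_z2bar f a))%BC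
  end.

(** [z1 + z2 i2 |-> f1 (z1 - z2 i1) e1 + f2 (z1 + z2 i1) e2]; the generating pair
    determined by [(F1, G1)] and [(F2, G2)] is [(combine_e F1 F2, combine_e G1 G2)]. *)
Definition combine_e (f1 f2 : C -> C) (a : BC) : BC :=
  (BC_of_C (f1 (fst a - snd a * Ci)%C) * e1
   + BC_of_C (f2 (fst a + snd a * Ci)%C) * e2)%BC.

Definition BC_vekua_a (k : dagger_index) (F G : BC -> BC) (a : BC) : BC :=
  (- ((dagger k (F a) * d_dagger k G a - d_dagger k F a * dagger k (G a))
      / (F a * dagger dag3 (G a) - dagger dag3 (F a) * G a)))%BC.
Definition BC_vekua_b (k : dagger_index) (F G : BC -> BC) (a : BC) : BC :=
  ((F a * d_dagger k G a - d_dagger k F a * G a)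
   / (F a * dagger dag3 (G a) - dagger dag3 (F a) * G a))%BC.

Definition BC_pseudoanalytic (D : BC -> Prop) (F G w : BC -> BC) : Prop :=
  BC_C1_on D w /\
  forall (k : dagger_index) (a : BC), D a ->
    d_dagger k w a
    = (BC_vekua_a k F G a * w a + BC_vekua_b k F G a * dagger dag3 (w a))%BC.

(** [d] is the [(F,G)_j]-derivative of [w] at [a0]. *)
Definition is_BC_FG_derivative (F G w : BC -> BC) (a0 d : BC) : Prop :=
  exists l m : BC,
    hyperbolic l /\ hyperbolic m /\
    w a0 = (l * F a0 + m * G a0)%BC /\
    filterlim (fun a : BC => ((w a - l * F a - m * G a) / (a - a0))%BC)
      (within (fun a : BC => invertible (a - a0)%BC) (locally a0)) (locally d).

(* Main.v *)
Require Import Defs.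
From Stdlib Require Import Reals Lra Classical.
From Coquelicot Require Import Coquelicot.

(** The two maps [z1 + z2 i2 |-> z1 - z2 i1] and [z1 + z2 i2 |-> z1 + z2 i1] are
    ring homomorphisms onto the complex numbers, and a bicomplex number is
    determined by its two images, its components.  Let [u] and [v] be the
    components of the variable.  Taken in the first component, the operators for
    the daggers 1, 2, 3 are [d/d(conj v)], [d/dv] and [d/d(conj u)]; in the second
    component the roles of [u] and [v] are exchanged ([component_d_dagger]).

    For the pair assembled from complex pairs, the first component of [F] and [G]
    is a function of [u] alone.  Hence the coefficients of the first two Vekua
    equations have zero first component, and these equations say that the first
    component of [w] has zero partial derivatives in [v]; the second domain being
    connected, it is a function [w1 u].  Since dagger 3 is complex conjugation in
    each component, the first component of the third equation is the complex
    Vekua equation of [w1] ([component_pseudoanalytic]).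

    For the derivative, [W = w1 - l F1 - m G1] vanishes at the point considered,
    and so does [dW/d(conj u)], because [F1], [G1] and [w1] solve the same
    real-linear Vekua equation.  Being continuously differentiable, [W] is then
    complex differentiable there, and the limit of its difference quotient exists
    ([pseudoanalytic_FG_quotient]).  The bicomplex quotient has the two complex
    quotients as components, and [a - a0] is invertible exactly when both of its
    components are nonzero ([is_BC_FG_derivative_assembled]).

    The sign [s] (1 or -1) selects the component, so that one argument serves both. *)

(** * Derivatives of complex and bicomplex functions *)

Lemma is_linear_Cmult (c : C) :
  is_linear (U := C_R_NormedModule) (V := C_R_NormedModule) (fun z : C => (c * z)%C).
Proof.
split.
- intros x y; exact (Cmult_plus_distr_l c x y).
- intros k [x y]; destruct c as [a b].
  unfold Cmult, scal; simpl; unfold prod_scal, scal, mult; simpl.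
  unfold mult; simpl; f_equal; ring.
- exists (Cmod c + 1); split; [generalize (Cmod_ge_0 c); lra|].
  intros z; rewrite <- !Cmod_norm, Cmod_mult; generalize (Cmod_ge_0 z); lra.
Qed.

Lemma is_linear_Cplus :
  is_linear (U := prod_NormedModule R_AbsRing C_R_NormedModule C_R_NormedModule)
    (V := C_R_NormedModule) (fun u : C * C => (fst u + snd u)%C).
Proof. exact (is_linear_plus (V := C_R_NormedModule)). Qed.

Lemma is_derive_linear {U V : NormedModule R_AbsRing} (l : U -> V) (f : R -> U)
  (t : R) (d : U) :
  is_linear l -> is_derive f t d -> is_derive (fun s => l (f s)) t (l d).
Proof.
intros Hl Hf.
apply filterdiff_ext_lin with (fun y : R => l (scal y d)).
- apply (filterdiff_comp' f l); [exact Hf|]. now apply filterdiff_linear.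
- intros y; now apply (linear_scal l).
Qed.

Lemma is_derive_C_Derive (f : R -> C) (t : R) (d : C) :
  is_derive (V := C_R_NormedModule) f t d -> C_Derive f t = d.
Proof.
intros H; destruct d as [a b]; unfold C_Derive; f_equal.
- apply is_derive_unique.
  exact (is_derive_linear (U := C_R_NormedModule) (V := R_NormedModule) _ f t _ is_linear_fst H).
- apply is_derive_unique.
  exact (is_derive_linear (U := C_R_NormedModule) (V := R_NormedModule) _ f t _ is_linear_snd H).
Qed.

Lemma is_derive_BC_Derive (f : R -> BC) (t : R) (d : BC) :
  is_derive (V := BC_R_NormedModule) f t d -> BC_Derive f t = d.
Proof.
intros H; destruct d as [a b]; unfold BC_Derive; f_equal.
- apply is_derive_C_Derive.
  exact (is_derive_linear (U := BC_R_NormedModule) (V := C_R_NormedModule) _ f t _ is_linear_fst H).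
- apply is_derive_C_Derive.
  exact (is_derive_linear (U := BC_R_NormedModule) (V := C_R_NormedModule) _ f t _ is_linear_snd H).
Qed.

Lemma ex_derive_C_Derive (f : R -> C) (t : R) :
  ex_derive (V := C_R_NormedModule) f t ->
  is_derive (V := C_R_NormedModule) f t (C_Derive f t).
Proof. intros [d Hd]; now rewrite (is_derive_C_Derive f t d Hd). Qed.

Lemma ex_derive_BC_Derive (f : R -> BC) (t : R) :
  ex_derive (V := BC_R_NormedModule) f t ->
  is_derive (V := BC_R_NormedModule) f t (BC_Derive f t).
Proof. intros [d Hd]; now rewrite (is_derive_BC_Derive f t d Hd). Qed.

(** A function with continuous partial derivatives is differentiable in the plane;
    this is applied to the real and imaginary parts, through the projection [p]. *)
Lemma C1_on_filterdiff (D : C -> Prop) (f : C -> C) (z : C) :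
  open D -> C1_on D f -> D z ->
  filterdiff (U := C_R_NormedModule) (V := C_R_NormedModule) f (locally z)
    (fun h : C => (RtoC (Re h) * d_x f z + RtoC (Im h) * d_y f z)%C).
Proof.
intros HD Hf Hz.
assert (Hpart : forall p : C -> R,
   is_linear (U := C_R_NormedModule) (V := R_NormedModule) p ->
   filterdiff (U := C_R_NormedModule) (V := R_NormedModule) (fun u => p (f u)) (locally z)
    (fun h : C => plus (scal (Re h) (p (d_x f z))) (scal (Im h) (p (d_y f z))))).
{ intros p Hp; destruct z as [x y].
  apply (filterdiff_ext (U := C_R_NormedModule) (V := R_NormedModule)
     (fun u => p (f (fst u, snd u)))); [now intros []|].
  apply (is_derive_filterdiff (fun s t => p (f (s, t))) x y
     (fun s t => p (d_x f (s, t))) (p (d_y f (x, y)))).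
  - apply (filter_imp D); [|exact (HD _ Hz)].
    intros [s t] Hst; destruct (Hf _ Hst) as [Hx _].
    exact (is_derive_linear p _ _ _ Hp (ex_derive_C_Derive _ _ Hx)).
  - destruct (Hf _ Hz) as [_ [Hy _]].
    exact (is_derive_linear p _ _ _ Hp (ex_derive_C_Derive _ _ Hy)).
  - destruct (Hf _ Hz) as [_ [_ [Hc _]]].
    apply (continuous_ext (fun u : R * R => p (d_x f u))); [now intros []|].
    apply (continuous_comp (d_x f) p); [exact Hc|].
    exact (linear_cont (K := R_AbsRing) (U := C_R_NormedModule) (V := R_NormedModule) p _ Hp). }
assert (H1 := Hpart Re is_linear_fst).
assert (H2 := Hpart Im is_linear_snd).
apply (filterdiff_ext (U := C_R_NormedModule) (V := C_R_NormedModule)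
   (fun u => (Re (f u), Im (f u)))).
{ intros u; now destruct (f u). }
eapply filterdiff_ext_lin.
- apply (filterdiff_comp'_2 (T := C_R_NormedModule) (U := R_NormedModule)
   (V := R_NormedModule) (W := C_R_NormedModule)
   (fun u => Re (f u)) (fun u => Im (f u)) (fun a b => (a, b)) z _ _
   (fun a b => (a, b)) H1 H2).
  apply filterdiff_linear.
  apply (is_linear_prod (T := prod_NormedModule R_AbsRing R_NormedModule R_NormedModule)
     (U := R_NormedModule) (V := R_NormedModule) fst snd).
  + apply is_linear_fst.
  + apply is_linear_snd.
- intros [a b]; destruct (d_x f z), (d_y f z).
  unfold plus, scal; simpl; unfold mult; simpl.
  unfold Cplus, Cmult; simpl; f_equal; ring.
Qed.

Lemma C1_on_is_derive_line (D : C -> Prop) (f : C -> C) (z v : C) (t0 : R) :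
  open D -> C1_on D f -> D z ->
  is_derive (V := C_R_NormedModule) (fun t => f (z + RtoC (t - t0) * v)%C) t0
    (RtoC (Re v) * d_x f z + RtoC (Im v) * d_y f z)%C.
Proof.
intros HD Hf Hz.
assert (Hz0 : (z + RtoC (t0 - t0) * v)%C = z) by (rewrite Rminus_diag; ring).
assert (Hl : is_derive (V := C_R_NormedModule) (fun t => z + RtoC (t - t0) * v)%C t0 v).
{ apply is_derive_ext with (fun t : R => plus (z - RtoC t0 * v : C_R_NormedModule)%C (scal t (v : C_R_NormedModule))).
  - intros t; destruct z, v; unfold plus, scal; simpl; unfold prod_plus, prod_scal, plus, scal, mult; simpl; unfold mult; simpl.
    unfold Cplus, Cmult, Cminus, Copp, RtoC; simpl. unfold Cplus; simpl. f_equal; ring.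
  - evar_last.
    2: { transitivity (plus zero (scal one (v : C_R_NormedModule))); [reflexivity|].
         now rewrite scal_one, plus_zero_l. }
    apply @is_derive_plus; [apply @is_derive_const|].
    apply (is_derive_scal_l (fun t : R => t) t0 one (v : C_R_NormedModule)).
    apply is_derive_id. }
eapply filterdiff_ext_lin.
- apply (filterdiff_comp' (fun t : R => z + RtoC (t - t0) * v : C_R_NormedModule)%C f t0 _
    (fun h : C => (RtoC (Re h) * d_x f z + RtoC (Im h) * d_y f z)%C : C_R_NormedModule) Hl).
  rewrite Hz0.
  exact (C1_on_filterdiff D f z HD Hf Hz).
- intros y; destruct v, (d_x f z), (d_y f z).
  unfold scal; simpl; unfold prod_scal, scal; simpl; unfold mult; simpl.
  unfold Cplus, Cmult; simpl; f_equal; ring.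
Qed.

(** * Idempotent components *)

(** For [s = 1] and [s = -1] this is the coefficient of [e1] and of [e2] in the
    idempotent representation. *)
Definition component (s : R) (a : BC) : C := (fst a - RtoC s * Ci * snd a)%C.

(** The bicomplex number with component [u] for [s] and [v] for [- s], in the
    coordinates [z1], [z2]. *)
Definition of_components (s : R) (u v : C) : BC :=
  (RtoC (/ 2) * (u + v), RtoC (s / 2) * Ci * (u - v))%C.

Definition sign (s : R) : Prop := s = 1 \/ s = -1.

Ltac C_coordinates :=
  cbv [component of_components BCplus BCminus BCopp BCmult BC_of_C i1 i2 j dagger
       Cplus Cminus Copp Cmult Cconj Ci RtoC Re Im fst snd];
  repeat match goal with |- (_, _) = (_, _) => apply f_equal2 end; field.

Lemma sign_opp s : sign s -> sign (- s).
Proof. intros [-> | ->]; [now right | left; ring]. Qed.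

Lemma of_components_opp s u v : of_components (- s) u v = of_components s v u.
Proof. destruct u, v; C_coordinates. Qed.

Lemma component_plus s a b : component s (a + b)%BC = (component s a + component s b)%C.
Proof. unfold component, BCplus; simpl; ring. Qed.

Lemma component_opp s a : component s (- a)%BC = (- component s a)%C.
Proof. unfold component, BCopp; simpl; ring. Qed.

Lemma component_minus s a b : component s (a - b)%BC = (component s a - component s b)%C.
Proof. unfold BCminus; now rewrite component_plus, component_opp. Qed.

Lemma component_mult s a b :
  sign s -> component s (a * b)%BC = (component s a * component s b)%C.
Proof.
intros [-> | ->]; destruct a as [[] []], b as [[] []]; C_coordinates.
Qed.

Lemma component_BC_of_C s z : component s (BC_of_C z) = z.
Proof. destruct z; C_coordinates. Qed.

Lemma component_i1 s : component s i1 = Ci.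
Proof. apply component_BC_of_C. Qed.

Lemma component_i2 s : component s i2 = (- (RtoC s * Ci))%C.
Proof. C_coordinates. Qed.

Lemma component_dag3 s a : component s (dagger dag3 a) = Cconj (component s a).
Proof. destruct a as [[] []]; C_coordinates. Qed.

Lemma component_of_components_same s u v :
  sign s -> component s (of_components s u v) = u.
Proof. intros [-> | ->]; destruct u, v; C_coordinates. Qed.

Lemma component_of_components_other s u v :
  sign s -> component (- s) (of_components s u v) = v.
Proof. intros [-> | ->]; destruct u, v; C_coordinates. Qed.

Lemma of_components_component s a :
  sign s -> of_components s (component s a) (component (- s) a) = a.
Proof. intros [-> | ->]; destruct a as [[] []]; C_coordinates. Qed.

Lemma component_ext s a b :
  sign s -> component s a = component s b -> component (- s) a = component (- s) b ->
  a = b.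
Proof.
intros Hs H1 H2.
now rewrite <- (of_components_component s a Hs), H1, H2, of_components_component.
Qed.

Lemma e1_e2_of_components u v :
  (BC_of_C u * e1 + BC_of_C v * e2)%BC = of_components 1 u v.
Proof.
unfold e1, e2. replace (/ RtoC 2)%C with (RtoC (/ 2)).
- destruct u, v; C_coordinates.
- apply RtoC_inv; lra.
Qed.

Lemma invertible_of_components s a :
  sign s -> component s a <> 0%C -> component (- s) a <> 0%C -> invertible a.
Proof.
intros Hs H1 H2.
exists (of_components s (/ component s a)%C (/ component (- s) a)%C).
assert (Hs' := sign_opp s Hs).
apply (component_ext s _ _ Hs);
  rewrite component_mult, component_BC_of_C by assumption.
- rewrite component_of_components_same by assumption; now field.
- rewrite component_of_components_other by assumption; now field.
Qed.

Lemma component_invertible s a : sign s -> invertible a -> component s a <> 0%C.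
Proof.
intros Hs [b Hb] H0.
apply (f_equal (component s)) in Hb.
rewrite component_mult, component_BC_of_C, H0 in Hb by assumption.
apply C1_nz; rewrite <- Hb; ring.
Qed.

Lemma component_div s a b :
  sign s -> invertible b -> component s (a / b)%BC = (component s a / component s b)%C.
Proof.
intros Hs Hb.
assert (H0 := component_invertible s b Hs Hb).
assert (H := f_equal (component s) (BCinv_r b Hb)).
rewrite component_mult, component_BC_of_C in H by assumption.
unfold BCdiv; rewrite component_mult by assumption.
replace (component s (BCinv b)) with (/ component s b)%C; [easy|].
transitivity (/ component s b * (component s b * component s (BCinv b)))%C.
- rewrite H; ring.
- now field.
Qed.

Lemma is_linear_Ccomb {T : NormedModule R_AbsRing} (l1 l2 : T -> C) (c1 c2 : C) :
  is_linear (V := C_R_NormedModule) l1 -> is_linear (V := C_R_NormedModule) l2 ->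
  is_linear (V := C_R_NormedModule) (fun x => c1 * l1 x + c2 * l2 x)%C.
Proof.
intros H1 H2.
apply (is_linear_comp (V := prod_NormedModule R_AbsRing C_R_NormedModule C_R_NormedModule)
  (W := C_R_NormedModule)
  (fun x => (c1 * l1 x, c2 * l2 x)%C) (fun u => (fst u + snd u)%C)).
2: exact is_linear_Cplus.
apply (is_linear_prod (U := C_R_NormedModule) (V := C_R_NormedModule)
  (fun x => c1 * l1 x)%C (fun x => c2 * l2 x)%C).
- exact (is_linear_comp (V := C_R_NormedModule) (W := C_R_NormedModule) l1 _ H1 (is_linear_Cmult c1)).
- exact (is_linear_comp (V := C_R_NormedModule) (W := C_R_NormedModule) l2 _ H2 (is_linear_Cmult c2)).
Qed.

Lemma is_linear_ext {U V : NormedModule R_AbsRing} (l l' : U -> V) :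
  (forall x, l x = l' x) -> is_linear l -> is_linear l'.
Proof.
intros E [H1 H2 [M [HM H3]]]; split.
- intros x y; rewrite <- !E; apply H1.
- intros k x; rewrite <- !E; apply H2.
- exists M; split; [exact HM|]; intros x; rewrite <- E; apply H3.
Qed.

Ltac C_ring :=
  lazymatch goal with |- ?x = ?y => change (@eq C x y) end; ring.

Lemma is_linear_component s :
  is_linear (U := BC_R_NormedModule) (V := C_R_NormedModule) (component s).
Proof.
apply (is_linear_ext (U := BC_R_NormedModule) (V := C_R_NormedModule)
   (fun a : C * C => RtoC 1 * fst a + (- (RtoC s * Ci)) * snd a)%C).
- intros a; unfold component; C_ring.
- apply (is_linear_Ccomb (T := BC_R_NormedModule) (fst : C * C -> C) (snd : C * C -> C)).
  + exact is_linear_fst.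
  + exact is_linear_snd.
Qed.

Lemma is_linear_of_components s :
  is_linear (U := BC_R_NormedModule) (V := BC_R_NormedModule)
    (fun p : C * C => of_components s (fst p) (snd p)).
Proof.
apply (is_linear_prod (T := BC_R_NormedModule) (U := C_R_NormedModule) (V := C_R_NormedModule)
  (fun p : C * C => RtoC (/ 2) * (fst p + snd p))%C
  (fun p : C * C => RtoC (s / 2) * Ci * (fst p - snd p))%C).
- apply (is_linear_ext (U := BC_R_NormedModule) (V := C_R_NormedModule)
    (fun p : C * C => RtoC (/ 2) * fst p + RtoC (/ 2) * snd p)%C); [intros p; C_ring|].
  apply (is_linear_Ccomb (T := BC_R_NormedModule) (fst : C * C -> C) (snd : C * C -> C)).
  + exact is_linear_fst.
  + exact is_linear_snd.
- apply (is_linear_ext (U := BC_R_NormedModule) (V := C_R_NormedModule)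
    (fun p : C * C => (RtoC (s / 2) * Ci) * fst p + (- (RtoC (s / 2) * Ci)) * snd p)%C);
    [intros p; C_ring|].
  apply (is_linear_Ccomb (T := BC_R_NormedModule) (fst : C * C -> C) (snd : C * C -> C)).
  + exact is_linear_fst.
  + exact is_linear_snd.
Qed.

(** * Partial derivatives in the idempotent variables *)

Lemma is_linear_continuous {U V : NormedModule R_AbsRing} (l : U -> V) (x : U) :
  is_linear l -> continuous l x.
Proof. intros Hl; exact (linear_cont l x Hl). Qed.

Lemma continuous_component s (a : BC) : continuous (component s) a.
Proof.
exact (is_linear_continuous (U := BC_R_NormedModule) (V := C_R_NormedModule)
  (component s) a (is_linear_component s)).
Qed.

Lemma continuous_of_components s (p : C * C) :
  continuous (fun p : C * C => of_components s (fst p) (snd p)) p.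
Proof.
exact (is_linear_continuous (U := BC_R_NormedModule) (V := BC_R_NormedModule)
  _ p (is_linear_of_components s)).
Qed.

Lemma continuous_of_components_own s (u v : C) :
  continuous (fun u : C => of_components s u v) u.
Proof.
apply (continuous_comp_2 (fun u : C => u) (fun _ : C => v) (of_components s)).
- apply continuous_id.
- apply continuous_const.
- apply continuous_of_components.
Qed.

Lemma continuous_Ccomb {T : UniformSpace} (f g : T -> C) (c1 c2 : C) (x : T) :
  continuous f x -> continuous g x ->
  continuous (fun y => c1 * f y + c2 * g y)%C x.
Proof.
intros Hf Hg.
apply (continuous_plus (V := C_R_NormedModule) (fun y => c1 * f y)%C (fun y => c2 * g y)%C).
- apply (continuous_comp f (fun z => c1 * z)%C); [exact Hf|].
  exact (is_linear_continuous (U := C_R_NormedModule) (V := C_R_NormedModule) _ _ (is_linear_Cmult c1)).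
- apply (continuous_comp g (fun z => c2 * z)%C); [exact Hg|].
  exact (is_linear_continuous (U := C_R_NormedModule) (V := C_R_NormedModule) _ _ (is_linear_Cmult c2)).
Qed.

Lemma open_components s (D D' : C -> Prop) :
  open D -> open D' ->
  open (fun a : BC => D (component s a) /\ D' (component (- s) a)).
Proof.
intros HD HD'; apply open_and.
- apply (open_comp (component s) D); [|exact HD].
  intros a _; apply continuous_component.
- apply (open_comp (component (- s)) D'); [|exact HD'].
  intros a _; apply continuous_component.
Qed.

(** With [a = of_components s u v], moving [Re u] or [Re v] changes only the
    coordinates [x1] and [y2], and moving [Im u] or [Im v] only [y1] and [x2].  The
    chain rule is thus only needed on the following two real planes through [a]. *)
Definition slice_x1y2 (a : BC) (u : C) : BC := ((Re u, Im (fst a)), (Re (snd a), Im u)).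
Definition slice_y1x2 (a : BC) (u : C) : BC := ((Re (fst a), Re u), (Im u, Im (snd a))).

Lemma continuous_slice_x1y2 a (u : C) : continuous (slice_x1y2 a) u.
Proof.
apply filterlim_locally; intros eps; exists eps.
intros v [H1 H2]; repeat split; try apply ball_center; assumption.
Qed.

Lemma continuous_slice_y1x2 a (u : C) : continuous (slice_y1x2 a) u.
Proof.
apply filterlim_locally; intros eps; exists eps.
intros v [H1 H2]; repeat split; try apply ball_center; assumption.
Qed.

Lemma C1_on_slice (D : BC -> Prop) (w dx dy : BC -> BC) (p : BC -> C) (S : C -> BC) :
  open D -> is_linear (U := BC_R_NormedModule) (V := C_R_NormedModule) p ->
  (forall u : C, continuous S u) ->
  (forall u, D (S u) ->
    is_derive (V := BC_R_NormedModule) (fun t => w (S (t, Im u))) (Re u) (dx (S u)) /\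
    is_derive (V := BC_R_NormedModule) (fun t => w (S (Re u, t))) (Im u) (dy (S u))) ->
  (forall a, D a -> continuous dx a /\ continuous dy a) ->
  C1_on (fun u => D (S u)) (fun u => p (w (S u))) /\
  (forall u, D (S u) ->
    d_x (fun u => p (w (S u))) u = p (dx (S u)) /\
    d_y (fun u => p (w (S u))) u = p (dy (S u))).
Proof.
intros HD Hp HS Hw Hc.
assert (Hd : forall u, D (S u) ->
  is_derive (V := C_R_NormedModule) (fun t => p (w (S (t, Im u)))) (Re u) (p (dx (S u))) /\
  is_derive (V := C_R_NormedModule) (fun t => p (w (S (Re u, t)))) (Im u) (p (dy (S u)))).
{ intros u Hu; destruct (Hw u Hu) as [Hx Hy]; split.
  - exact (is_derive_linear (U := BC_R_NormedModule) (V := C_R_NormedModule) p _ _ _ Hp Hx).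
  - exact (is_derive_linear (U := BC_R_NormedModule) (V := C_R_NormedModule) p _ _ _ Hp Hy). }
assert (He : forall u, D (S u) ->
    d_x (fun u => p (w (S u))) u = p (dx (S u)) /\
    d_y (fun u => p (w (S u))) u = p (dy (S u))).
{ intros u Hu; destruct (Hd u Hu); split; now apply is_derive_C_Derive. }
split; [|exact He].
intros u Hu.
assert (Hloc : locally u (fun v => D (S v))) by exact (HS u _ (HD _ Hu)).
assert (Hcont : forall g : BC -> BC, continuous g (S u) -> continuous (fun v => p (g (S v))) u).
{ intros g Hg.
  apply (continuous_comp (fun v => g (S v)) p).
  - exact (continuous_comp S g u (HS u) Hg).
  - exact (is_linear_continuous (U := BC_R_NormedModule) (V := C_R_NormedModule) p _ Hp). }
destruct (Hc _ Hu) as [Cx Cy].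
repeat split.
- eexists; apply (proj1 (Hd u Hu)).
- eexists; apply (proj2 (Hd u Hu)).
- apply (continuous_ext_loc _ (fun v => p (dx (S v)))); [|now apply Hcont].
  refine (filter_imp _ _ _ Hloc); intros v Hv; symmetry; now apply He.
- apply (continuous_ext_loc _ (fun v => p (dy (S v)))); [|now apply Hcont].
  refine (filter_imp _ _ _ Hloc); intros v Hv; symmetry; now apply He.
Qed.

(** The partial derivatives in the [v] variable follow from these by
    [of_components_opp]; for that use [p] must be independent of [s]. *)
Lemma is_derive_component_x (D : BC -> Prop) (w : BC -> BC) (p : BC -> C) s (u v : C) :
  open D -> BC_C1_on D w ->
  is_linear (U := BC_R_NormedModule) (V := C_R_NormedModule) p ->
  let a := of_components s u v in
  D a ->
  is_derive (V := C_R_NormedModule) (fun t => p (w (of_components s (t, Im u) v))) (Re u)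
    (RtoC (/ 2) * p (d_x1 w a) + RtoC (s / 2) * p (d_y2 w a))%C.
Proof.
intros HD Hw Hp a Ha.
destruct (C1_on_slice D w (d_x1 w) (d_y2 w) p (slice_x1y2 a)) as [H1 H2]; try assumption.
- apply continuous_slice_x1y2.
- intros z Hz; destruct (Hw _ Hz) as [[Hx [_ [_ Hy]]] _].
  split; [exact (ex_derive_BC_Derive _ _ Hx) | exact (ex_derive_BC_Derive _ _ Hy)].
- intros b Hb; now destruct (Hw b Hb) as [_ [? [_ [_ ?]]]].
- pose (z := (Re (fst a), Im (snd a)) : C).
  assert (Ez : slice_x1y2 a z = a) by (now destruct a as [[] []]).
  assert (Hz : D (slice_x1y2 a z)) by (now rewrite Ez).
  destruct (H2 z Hz) as [Hx Hy].
  assert (Ho : open (fun z => D (slice_x1y2 a z))).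
  { apply (open_comp (slice_x1y2 a) D); [|exact HD].
    intros ? _; apply continuous_slice_x1y2. }
  assert (H := C1_on_is_derive_line _ _ z (/ 2, s / 2) (Re u) Ho H1 Hz).
  rewrite Hx, Hy, Ez in H.
  refine (is_derive_ext _ _ _ _ _ H).
  intros t; do 2 f_equal; unfold z, a, slice_x1y2; destruct u, v; C_coordinates.
Qed.

Lemma is_derive_component_y (D : BC -> Prop) (w : BC -> BC) (p : BC -> C) s (u v : C) :
  open D -> BC_C1_on D w ->
  is_linear (U := BC_R_NormedModule) (V := C_R_NormedModule) p ->
  let a := of_components s u v in
  D a ->
  is_derive (V := C_R_NormedModule) (fun t => p (w (of_components s (Re u, t) v))) (Im u)
    (RtoC (/ 2) * p (d_y1 w a) + RtoC (- s / 2) * p (d_x2 w a))%C.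
Proof.
intros HD Hw Hp a Ha.
destruct (C1_on_slice D w (d_y1 w) (d_x2 w) p (slice_y1x2 a)) as [H1 H2]; try assumption.
- apply continuous_slice_y1x2.
- intros z Hz; destruct (Hw _ Hz) as [[_ [Hx [Hy _]]] _].
  split; [exact (ex_derive_BC_Derive _ _ Hx) | exact (ex_derive_BC_Derive _ _ Hy)].
- intros b Hb; now destruct (Hw b Hb) as [_ [_ [? [? _]]]].
- pose (z := (Im (fst a), Re (snd a)) : C).
  assert (Ez : slice_y1x2 a z = a) by (now destruct a as [[] []]).
  assert (Hz : D (slice_y1x2 a z)) by (now rewrite Ez).
  destruct (H2 z Hz) as [Hx Hy].
  assert (Ho : open (fun z => D (slice_y1x2 a z))).
  { apply (open_comp (slice_y1x2 a) D); [|exact HD].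
    intros ? _; apply continuous_slice_y1x2. }
  assert (H := C1_on_is_derive_line _ _ z (/ 2, - s / 2) (Im u) Ho H1 Hz).
  rewrite Hx, Hy, Ez in H.
  refine (is_derive_ext _ _ _ _ _ H).
  intros t; do 2 f_equal; unfold z, a, slice_y1x2; destruct u, v; C_coordinates.
Qed.

(** In terms of the idempotent variables [u], [v] these are half of
    [d/dx + i d/dy] and [d/dx - i d/dy] in [v], and of [d/dx + i d/dy] in [u]. *)
Lemma component_d_dagger s (h : BC -> BC) (a : BC) :
  sign s ->
  let X1 := component s (d_x1 h a) in let Y1 := component s (d_y1 h a) in
  let X2 := component s (d_x2 h a) in let Y2 := component s (d_y2 h a) in
  component s (d_dagger dag1 h a)
  = (RtoC (/ 4) * (X1 + Ci * Y1 + RtoC s * Ci * X2 - RtoC s * Y2))%C /\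
  component s (d_dagger dag2 h a)
  = (RtoC (/ 4) * (X1 - Ci * Y1 - RtoC s * Ci * X2 - RtoC s * Y2))%C /\
  component s (d_dagger dag3 h a)
  = (RtoC (/ 4) * (X1 + Ci * Y1 - RtoC s * Ci * X2 + RtoC s * Y2))%C.
Proof.
intros Hs X1 Y1 X2 Y2.
unfold d_dagger, d_z1, d_z2, d_z1bar, d_z2bar.
rewrite !component_mult, !component_plus, !component_minus, !component_mult,
  !component_plus, !component_minus, !component_mult, !component_i1, !component_i2,
  !component_BC_of_C by assumption.
fold X1 Y1 X2 Y2.
replace (/ RtoC 2)%C with (RtoC (/ 2)) by (apply RtoC_inv; lra).
destruct X1, Y1, X2, Y2.
destruct Hs as [-> | ->]; repeat split; C_coordinates.
Qed.

(** * Functions with zero partial derivatives on a connected open set *)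

Lemma derive_zero_eq (f : R -> C) (a b : R) :
  (forall t, Rmin a b <= t <= Rmax a b ->
     is_derive (V := C_R_NormedModule) f t (RtoC 0)) ->
  f a = f b.
Proof.
intros H.
destruct (Rtotal_order a b) as [Hab | [-> | Hab]]; [|reflexivity|].
- apply (eq_is_derive (V := C_R_NormedModule) f a b); [|exact Hab].
  intros t Ht; apply H; rewrite Rmin_left, Rmax_right; lra.
- symmetry; apply (eq_is_derive (V := C_R_NormedModule) f b a); [|exact Hab].
  intros t Ht; apply H; rewrite Rmin_right, Rmax_left; lra.
Qed.

Lemma ball_between (x y e t : R) :
  ball x e y -> Rmin x y <= t <= Rmax x y -> ball x e t.
Proof.
unfold ball; simpl; unfold AbsRing_ball, abs, minus, plus, opp; simpl.
intros H Ht.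
apply Rabs_def2 in H; apply Rabs_def1; unfold Rmin, Rmax in Ht;
  destruct (Rle_dec x y); lra.
Qed.

(** The balls of [C] are squares: two points of a ball are joined by a vertical and
    a horizontal segment inside it, so [f] is locally constant and its level sets in
    [D] are open. *)
Lemma constant_of_partials_zero (D : C -> Prop) (f : C -> C) :
  open_domain D ->
  (forall z, D z ->
    is_derive (V := C_R_NormedModule) (fun t => f (t, Im z)) (Re z) (RtoC 0) /\
    is_derive (V := C_R_NormedModule) (fun t => f (Re z, t)) (Im z) (RtoC 0)) ->
  forall p q, D p -> D q -> f p = f q.
Proof.
intros [HD Hc] Hf p q Hp Hq.
assert (Hloc : forall z, D z -> locally z (fun v => D v /\ f v = f z)).
{ intros [x y] Hz; destruct (HD _ Hz) as [e He]; exists e.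
  intros [x' y'] [Hx Hy]; simpl in Hx, Hy.
  split; [now apply He; split|].
  transitivity (f (x', y)).
  - apply (derive_zero_eq (fun t => f (x', t)) y' y).
    intros t Ht; apply (Hf (x', t)), He; split; [exact Hx|].
    apply (ball_between y y' e t Hy); now rewrite Rmin_comm, Rmax_comm.
  - apply (derive_zero_eq (fun t => f (t, y)) x' x).
    intros t Ht; apply (Hf (t, y)), He; split; [|apply ball_center].
    apply (ball_between x x' e t Hx); now rewrite Rmin_comm, Rmax_comm. }
apply NNPP; intros Hpq.
destruct (Hc (fun z => D z /\ f z = f p) (fun z => D z /\ f z <> f p))
  as [z [_ [[_ H1] [_ H2]]]]; [| | | | |now apply H2].
- intros z [Hz E]; refine (filter_imp _ _ _ (Hloc z Hz)).
  intros v [Hv Ev]; split; [exact Hv | now rewrite Ev].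
- intros z [Hz E]; refine (filter_imp _ _ _ (Hloc z Hz)).
  intros v [Hv Ev]; split; [exact Hv | now rewrite Ev].
- intros z Hz; destruct (classic (f z = f p)); [left | right]; easy.
- now exists p.
- now exists q.
Qed.

(** * Generating pairs and the complex derivative *)

(** The denominator is [-2i] times [Im (conj F * G)]. *)
Lemma generating_pair_denominator (D : C -> Prop) (F G : C -> C) (z : C) :
  generating_pair D F G -> D z ->
  (F z * Cconj (G z) - Cconj (F z) * G z)%C <> 0%C.
Proof.
intros [_ [_ H]] Hz E; apply (H z Hz).
apply (f_equal Im) in E.
destruct (F z), (G z); cbv [Cplus Cminus Copp Cmult Cconj Ci RtoC Re Im fst snd] in *.
lra.
Qed.

Lemma generating_pair_C1 (D : C -> Prop) (F G : C -> C) :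
  generating_pair D F G -> C1_on D F /\ C1_on D G.
Proof. now intros [[? _] [[? _] _]]. Qed.

(** Cramer's rule: the determinant of the real system is [Im (conj F * G)]. *)
Lemma generating_pair_span (D : C -> Prop) (F G : C -> C) (z c : C) :
  generating_pair D F G -> D z ->
  exists l m : R, c = (RtoC l * F z + RtoC m * G z)%C.
Proof.
intros [_ [_ H]] Hz; specialize (H z Hz).
destruct c as [x y], (F z) as [a b], (G z) as [c d].
cbv [Cmult Cconj Im fst snd] in H.
exists ((x * d - y * c) / (a * d + - b * c)), ((a * y - b * x) / (a * d + - b * c)).
C_coordinates; exact H.
Qed.

(** [a] and [b] are the coefficients solving these two equations; this makes every
    real combination of [F] and [G] a solution of the Vekua equation. *)
Lemma vekua_generators (D : C -> Prop) (F G : C -> C) (z : C) :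
  generating_pair D F G -> D z ->
  d_zbar F z = (vekua_a F G z * F z + vekua_b F G z * Cconj (F z))%C /\
  d_zbar G z = (vekua_a F G z * G z + vekua_b F G z * Cconj (G z))%C.
Proof.
intros HFG Hz; assert (H := generating_pair_denominator D F G z HFG Hz).
unfold vekua_a, vekua_b; split; field; exact H.
Qed.

Lemma filterlim_difference_quotient (f : C -> C) (z0 d : C) :
  filterdiff (U := C_R_NormedModule) (V := C_R_NormedModule) f (locally z0)
    (fun h : C => (h * d)%C) ->
  filterlim (fun z => (f z - f z0) / (z - z0))%C (locally' z0) (locally d).
Proof.
intros [_ H]; specialize (H z0 (fun P HP => HP)).
apply filterlim_locally; intros eps.
unfold locally', within.
refine (filter_imp _ _ _ (H (pos_div_2 eps))).
intros z Hz Hne.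
apply (norm_compat1 (V := C_R_NormedModule)).
rewrite <- !Cmod_norm in *.
change (Cmod ((f z - f z0) / (z - z0) - d)%C < eps).
change (Cmod ((f z - f z0) - (z - z0) * d)%C <= eps / 2 * Cmod (z - z0)%C) in Hz.
assert (H0 : (z - z0)%C <> 0%C) by now apply Cminus_eq_contra.
replace ((f z - f z0) / (z - z0) - d)%C
  with (((f z - f z0) - (z - z0) * d) / (z - z0))%C by (field; exact H0).
rewrite Cmod_div by exact H0.
assert (Hpos : 0 < Cmod (z - z0)%C) by (now apply Cmod_gt_0).
apply Rle_lt_trans with (eps / 2).
- apply (Rmult_le_reg_r (Cmod (z - z0)%C)); [exact Hpos|].
  unfold Rdiv at 1; rewrite Rmult_assoc, Rinv_l by lra. lra.
- generalize (cond_pos eps); lra.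
Qed.

(** The differential of [W = w - l F - m G] at [z0] is multiplication by [d_x W z0], since
    [d_zbar W z0 = 0] means [d_y W z0 = i d_x W z0]. *)
Lemma pseudoanalytic_FG_quotient (D : C -> Prop) (F G w : C -> C) (z0 : C) (l m : R) :
  open D -> generating_pair D F G -> pseudoanalytic D F G w -> D z0 ->
  w z0 = (RtoC l * F z0 + RtoC m * G z0)%C ->
  filterlim (fun z : C => ((w z - RtoC l * F z - RtoC m * G z) / (z - z0))%C)
    (locally' z0) (locally (d_x w z0 - RtoC l * d_x F z0 - RtoC m * d_x G z0)%C).
Proof.
intros HD HFG [Hw Hv] Hz E.
destruct (generating_pair_C1 _ _ _ HFG) as [HF HG].
destruct (vekua_generators _ _ _ _ HFG Hz) as [VF VG].
assert (Vw := Hv z0 Hz).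
pose (W := fun z => (w z - RtoC l * F z - RtoC m * G z)%C).
assert (EW : W z0 = 0%C) by (unfold W; rewrite E; ring).
assert (Hbar : (d_zbar w z0 = RtoC l * d_zbar F z0 + RtoC m * d_zbar G z0)%C).
{ rewrite Vw, VF, VG, E, Cplus_conj, !Cmult_conj.
  replace (Cconj (RtoC l)) with (RtoC l) by C_coordinates.
  replace (Cconj (RtoC m)) with (RtoC m) by C_coordinates.
  ring. }
pose (d := (d_x w z0 - RtoC l * d_x F z0 - RtoC m * d_x G z0)%C).
assert (Hy : (d_y w z0 - RtoC l * d_y F z0 - RtoC m * d_y G z0 = Ci * d)%C).
{ unfold d_zbar in Hbar; unfold d.
  replace (/ RtoC 2)%C with (RtoC (/ 2)) in Hbar by (apply RtoC_inv; lra).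
  destruct (d_x w z0), (d_y w z0), (d_x F z0), (d_y F z0), (d_x G z0), (d_y G z0).
  cbv [Cplus Cminus Copp Cmult Ci RtoC Re Im fst snd] in *.
  injection Hbar as H1 H2; f_equal; lra. }
apply (filterlim_ext (fun z => (W z - W z0) / (z - z0))%C).
{ intros z; rewrite EW; unfold W; f_equal; ring. }
apply (filterlim_difference_quotient W z0 d).
assert (DF := C1_on_filterdiff D F z0 HD HF Hz).
assert (DG := C1_on_filterdiff D G z0 HD HG Hz).
assert (Dw := C1_on_filterdiff D w z0 HD Hw Hz).
assert (Hscal : forall (c : C) (f lf : C -> C),
  filterdiff (U := C_R_NormedModule) (V := C_R_NormedModule) f (locally z0) lf ->
  filterdiff (U := C_R_NormedModule) (V := C_R_NormedModule)
    (fun z => c * f z)%C (locally z0) (fun h => c * lf h)%C).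
{ intros c f lf Hf.
  apply (filterdiff_comp' (U := C_R_NormedModule) (V := C_R_NormedModule)
    (W := C_R_NormedModule) f (fun z => c * z)%C z0 lf (fun z => c * z)%C Hf).
  apply filterdiff_linear, is_linear_Cmult. }
refine (filterdiff_ext_lin _ _ _ (filterdiff_minus_fct (V := C_R_NormedModule) _ _ _ _
  (filterdiff_minus_fct (V := C_R_NormedModule) _ _ _ _ Dw (Hscal (RtoC l) _ _ DF))
  (Hscal (RtoC m) _ _ DG)) _).
intros h.
transitivity (RtoC (Re h) * d
  + RtoC (Im h) * (d_y w z0 - RtoC l * d_y F z0 - RtoC m * d_y G z0))%C.
- unfold d; change (@minus C_R_NormedModule) with Cminus; C_ring.
- rewrite Hy; destruct h, d; C_coordinates.
Qed.

(** * One component of a bicomplex pseudoanalytic function *)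

Definition assembles (s : R) (F F' : C -> C) (FF : BC -> BC) : Prop :=
  forall a, FF a = of_components s (F (component s a)) (F' (component (- s) a)).

Definition component_domain (s : R) (D D' : C -> Prop) (a : BC) : Prop :=
  D (component s a) /\ D' (component (- s) a).

Lemma component_BC_Derive_line (D D' : C -> Prop) (F F' : C -> C) (FF : BC -> BC)
  (s : R) (a : BC) (line : R -> BC) (t0 : R) (v v' : C) :
  sign s -> open D -> open D' -> C1_on D F -> C1_on D' F' -> assembles s F F' FF ->
  component_domain s D D' a ->
  (forall t, component s (line t) = component s a + RtoC (t - t0) * v)%C ->
  (forall t, component (- s) (line t) = component (- s) a + RtoC (t - t0) * v')%C ->
  component s (BC_Derive (fun t => FF (line t)) t0)
  = (RtoC (Re v) * d_x F (component s a) + RtoC (Im v) * d_y F (component s a))%C.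
Proof.
intros Hs HD HD' HF HF' HFF [Ha Ha'] Hv Hv'.
assert (H := C1_on_is_derive_line D F _ v t0 HD HF Ha).
assert (H' := C1_on_is_derive_line D' F' _ v' t0 HD' HF' Ha').
set (d := (RtoC (Re v) * _ + _)%C) in *.
set (d' := (RtoC (Re v') * _ + _)%C) in *.
rewrite (is_derive_BC_Derive _ _ (of_components s d d')).
- now apply component_of_components_same.
- apply (is_derive_ext (V := BC_R_NormedModule)
    (fun t => of_components s (F (component s a + RtoC (t - t0) * v)%C)
      (F' (component (- s) a + RtoC (t - t0) * v')%C))).
  { intros t; now rewrite HFF, Hv, Hv'. }
  refine (filterdiff_ext_lin _ _ _ (filterdiff_comp'_2 (T := R_NormedModule)
    (U := C_R_NormedModule) (V := C_R_NormedModule) (W := BC_R_NormedModule)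
    _ _ (of_components s) t0 _ _ (of_components s) H H'
    (filterdiff_linear _ (is_linear_of_components s))) _).
  intros t; exact (linear_scal (U := BC_R_NormedModule) (V := BC_R_NormedModule) _
    (is_linear_of_components s) t (d, d')).
Qed.

(** The component of [FF] depends on its own variable only, and holomorphic and
    antiholomorphic derivatives in the other one vanish. *)
Lemma component_d_dagger_assembled (D D' : C -> Prop) (F F' : C -> C) (FF : BC -> BC)
  (s : R) (a : BC) :
  sign s -> open D -> open D' -> C1_on D F -> C1_on D' F' -> assembles s F F' FF ->
  component_domain s D D' a ->
  component s (d_dagger dag1 FF a) = 0%C /\ component s (d_dagger dag2 FF a) = 0%C /\
  component s (d_dagger dag3 FF a) = d_zbar F (component s a).
Proof.
intros Hs HD HD' HF HF' HFF Ha.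
pose (L := component_BC_Derive_line D D' F F' FF s a).
(* The two complex numbers are the velocities of the components along the line. *)
assert (HX1 := L (fun t => ((t, Im (fst a)), snd a)) (Re (fst a)) (1, 0) (1, 0)
  Hs HD HD' HF HF' HFF Ha).
assert (HY1 := L (fun t => ((Re (fst a), t), snd a)) (Im (fst a)) (0, 1) (0, 1)
  Hs HD HD' HF HF' HFF Ha).
assert (HX2 := L (fun t => (fst a, (t, Im (snd a)))) (Re (snd a)) (0, - s) (0, s)
  Hs HD HD' HF HF' HFF Ha).
assert (HY2 := L (fun t => (fst a, (Re (snd a), t))) (Im (snd a)) (s, 0) (- s, 0)
  Hs HD HD' HF HF' HFF Ha).
clear L.
destruct (component_d_dagger s FF a Hs) as [-> [-> ->]].
unfold d_x1, d_y1, d_x2, d_y2, d_zbar, line_x1, line_y1, line_x2, line_y2.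
rewrite HX1, HY1, HX2, HY2;
  try (intros t; destruct a as [[] []]; C_coordinates).
replace (/ RtoC 2)%C with (RtoC (/ 2)) by (apply RtoC_inv; lra).
destruct (d_x F (component s a)), (d_y F (component s a)).
destruct Hs as [-> | ->]; repeat split; C_coordinates.
Qed.

(** [w1] is the restriction of the component of [w] to a slice [v = p]. *)
Lemma component_pseudoanalytic (D D' : C -> Prop) (F G F' G' : C -> C)
  (FF GG w : BC -> BC) (s : R) :
  sign s -> open D -> open_domain D' ->
  generating_pair D F G -> generating_pair D' F' G' ->
  assembles s F F' FF -> assembles s G G' GG ->
  BC_pseudoanalytic (component_domain s D D') FF GG w ->
  exists w1 : C -> C,
    pseudoanalytic D F G w1 /\
    forall a, component_domain s D D' a -> component s (w a) = w1 (component s a).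
Proof.
intros Hs HD HD' HFG HFG' HFF HGG [Hw Hv].
destruct (classic (exists p, D' p)) as [[p Hp] | Hempty].
(* With [D'] empty there is no slice; the zero function solves the Vekua equation. *)
2: { exists (fun _ => RtoC 0).
  assert (Hc : forall t : R, C_Derive (fun _ => RtoC 0) t = RtoC 0).
  { intros t; apply is_derive_C_Derive, (is_derive_const (V := C_R_NormedModule)). }
  split; [split|].
  - intros z _; repeat split.
    + apply (ex_derive_const (V := C_R_NormedModule)).
    + apply (ex_derive_const (V := C_R_NormedModule)).
    + apply (continuous_ext (fun _ => RtoC 0)); [|apply continuous_const].
      intros u; symmetry; apply Hc.
    + apply (continuous_ext (fun _ => RtoC 0)); [|apply continuous_const].
      intros u; symmetry; apply Hc.
  - intros z _; unfold d_zbar, d_x, d_y; rewrite !Hc.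
    replace (Cconj (RtoC 0)) with (RtoC 0) by C_coordinates. ring.
  - intros a [_ Ha]; exfalso; apply Hempty; now exists (component (- s) a). }
assert (HoD' := proj1 HD').
assert (Ho : open (component_domain s D D')) by now apply open_components.
assert (Hdom : forall u v, D u -> D' v ->
  component_domain s D D' (of_components s u v)).
{ intros u v Hu Hv'; split.
  - now rewrite component_of_components_same.
  - now rewrite component_of_components_other. }
destruct (generating_pair_C1 _ _ _ HFG) as [HF HG].
destruct (generating_pair_C1 _ _ _ HFG') as [HF' HG'].
assert (Hs' := sign_opp s Hs).
assert (HcF : forall a, component s (FF a) = F (component s a))
  by (intros a; rewrite HFF; now apply component_of_components_same).
assert (HcG : forall a, component s (GG a) = G (component s a))
  by (intros a; rewrite HGG; now apply component_of_components_same).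
assert (Hden : forall a, component_domain s D D' a ->
  invertible (FF a * dagger dag3 (GG a) - dagger dag3 (FF a) * GG a)%BC).
{ intros a [Ha Ha']; apply (invertible_of_components s); [exact Hs | |];
    rewrite component_minus, !component_mult, !component_dag3 by assumption.
  - rewrite HcF, HcG; now apply (generating_pair_denominator D).
  - rewrite HFF, HGG, !component_of_components_other by assumption.
    now apply (generating_pair_denominator D'). }
assert (Hzero : forall k a, k <> dag3 -> component_domain s D D' a ->
  component s (d_dagger k w a) = 0%C).
{ intros k a Hk Ha; rewrite (Hv k a Ha); unfold BC_vekua_a, BC_vekua_b.
  assert (E : component s (d_dagger k FF a) = 0%C /\ component s (d_dagger k GG a) = 0%C).
  { destruct (component_d_dagger_assembled D D' F F' FF s a Hs HD HoD' HF HF' HFF Ha)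
      as [E1 [E2 _]].
    destruct (component_d_dagger_assembled D D' G G' GG s a Hs HD HoD' HG HG' HGG Ha)
      as [E1' [E2' _]].
    destruct k; [exact (conj E1 E1') | exact (conj E2 E2') | contradiction]. }
  destruct E as [E1 E2].
  rewrite component_plus, !component_mult, component_opp, !component_div,
    !component_minus, !component_mult, E1, E2 by (try assumption; now apply Hden).
  unfold Cdiv; ring. }
assert (Hpart : forall a, component_domain s D D' a ->
  component s (d_x1 w a) = (RtoC s * component s (d_y2 w a))%C /\
  component s (d_y1 w a) = (- (RtoC s * component s (d_x2 w a)))%C).
{ intros a Ha.
  assert (H1 := Hzero dag1 a ltac:(discriminate) Ha).
  assert (H2 := Hzero dag2 a ltac:(discriminate) Ha).
  destruct (component_d_dagger s w a Hs) as [E1 [E2 _]].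
  rewrite E1 in H1; rewrite E2 in H2; clear E1 E2.
  destruct (component s (d_x1 w a)), (component s (d_y1 w a)),
    (component s (d_x2 w a)), (component s (d_y2 w a)).
  cbv [Cplus Cminus Copp Cmult Ci RtoC Re Im fst snd] in *.
  injection H1; injection H2; intros.
  split; f_equal; lra. }
(* Connectedness of [D'] makes the component independent of [v]. *)
assert (Hind : forall u v v', D u -> D' v -> D' v' ->
  component s (w (of_components s u v)) = component s (w (of_components s u v'))).
{ intros u v v' Hu; apply (constant_of_partials_zero D'
    (fun v => component s (w (of_components s u v)))); [exact HD'|].
  clear v v'; intros v Hv'.
  destruct (Hpart _ (Hdom u v Hu Hv')) as [P1 P2].
  rewrite <- of_components_opp in P1, P2.
  assert (Hd := Hdom u v Hu Hv').
  rewrite <- of_components_opp in Hd.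
  assert (Hx := is_derive_component_x _ w (component s) (- s) v u Ho Hw
    (is_linear_component s) Hd).
  assert (Hy := is_derive_component_y _ w (component s) (- s) v u Ho Hw
    (is_linear_component s) Hd).
  rewrite P1 in Hx; rewrite P2 in Hy.
  split.
  - replace (RtoC 0) with
      (RtoC (/ 2) * (RtoC s * component s (d_y2 w (of_components (- s) v u)))
       + RtoC (- s / 2) * component s (d_y2 w (of_components (- s) v u)))%C.
    + refine (is_derive_ext _ _ _ _ _ Hx); intros t; now rewrite of_components_opp.
    + destruct (component s (d_y2 w (of_components (- s) v u))); C_coordinates.
  - replace (RtoC 0) with
      (RtoC (/ 2) * (- (RtoC s * component s (d_x2 w (of_components (- s) v u))))
       + RtoC (- - s / 2) * component s (d_x2 w (of_components (- s) v u)))%C.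
    + refine (is_derive_ext _ _ _ _ _ Hy); intros t; now rewrite of_components_opp.
    + destruct (component s (d_x2 w (of_components (- s) v u))); C_coordinates. }
pose (w1 := fun z => component s (w (of_components s z p))).
exists w1.
assert (Hdx : forall z, D z ->
   is_derive (V := C_R_NormedModule)
     (fun t => w1 (t, Im z)) (Re z)
     (RtoC (/ 2) * component s (d_x1 w (of_components s z p))
      + RtoC (s / 2) * component s (d_y2 w (of_components s z p)))%C).
{ intros z Hz; apply (is_derive_component_x (component_domain s D D')); try assumption.
  - apply is_linear_component.
  - now apply Hdom. }
assert (Hdy : forall z, D z ->
   is_derive (V := C_R_NormedModule)
     (fun t => w1 (Re z, t)) (Im z)
     (RtoC (/ 2) * component s (d_y1 w (of_components s z p))
      + RtoC (- s / 2) * component s (d_x2 w (of_components s z p)))%C).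
{ intros z Hz; apply (is_derive_component_y (component_domain s D D')); try assumption.
  - apply is_linear_component.
  - now apply Hdom. }
split; [split|].
- intros z Hz.
  destruct (Hw _ (Hdom z p Hz Hp)) as [_ [C1 [C2 [C3 C4]]]].
  assert (Hcont : forall g : BC -> BC, continuous g (of_components s z p) ->
    continuous (fun z => component s (g (of_components s z p))) z).
  { intros g Hg; apply (continuous_comp (fun z => g (of_components s z p)) (component s)).
    - apply (continuous_comp (fun z => of_components s z p) g); [|exact Hg].
      apply continuous_of_components_own.
    - apply continuous_component. }
  repeat split.
  + eexists; apply (Hdx z Hz).
  + eexists; apply (Hdy z Hz).
  + refine (continuous_ext_loc _ _ _ _ (continuous_Ccomb _ _ (RtoC (/ 2)) (RtoC (s / 2)) _
      (Hcont _ C1) (Hcont _ C4))).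
    refine (filter_imp _ _ _ (HD z Hz)).
    intros u Hu; symmetry; exact (is_derive_C_Derive _ _ _ (Hdx u Hu)).
  + refine (continuous_ext_loc _ _ _ _ (continuous_Ccomb _ _ (RtoC (/ 2)) (RtoC (- s / 2)) _
      (Hcont _ C2) (Hcont _ C3))).
    refine (filter_imp _ _ _ (HD z Hz)).
    intros u Hu; symmetry; exact (is_derive_C_Derive _ _ _ (Hdy u Hu)).
- intros z Hz; set (a := of_components s z p).
  assert (Ha : component_domain s D D' a) by now apply Hdom.
  assert (Ez : component s a = z) by now apply component_of_components_same.
  transitivity (component s (d_dagger dag3 w a)).
  + destruct (component_d_dagger s w a Hs) as [_ [_ ->]].
    unfold d_zbar.
    replace (d_x w1 z) with
      (RtoC (/ 2) * component s (d_x1 w a) + RtoC (s / 2) * component s (d_y2 w a))%C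
      by (symmetry; exact (is_derive_C_Derive _ _ _ (Hdx z Hz))).
    replace (d_y w1 z) with
      (RtoC (/ 2) * component s (d_y1 w a) + RtoC (- s / 2) * component s (d_x2 w a))%C
      by (symmetry; exact (is_derive_C_Derive _ _ _ (Hdy z Hz))).
    replace (/ RtoC 2)%C with (RtoC (/ 2)) by (apply RtoC_inv; lra).
    destruct (component s (d_x1 w a)), (component s (d_y1 w a)),
      (component s (d_x2 w a)), (component s (d_y2 w a)).
    C_coordinates.
  + rewrite (Hv dag3 a Ha); unfold BC_vekua_a, BC_vekua_b, vekua_a, vekua_b.
    destruct (component_d_dagger_assembled D D' F F' FF s a Hs HD HoD' HF HF' HFF Ha)
      as [_ [_ EF]].
    destruct (component_d_dagger_assembled D D' G G' GG s a Hs HD HoD' HG HG' HGG Ha)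
      as [_ [_ EG]].
    rewrite component_plus, !component_mult, component_opp, !component_div,
      !component_minus, !component_mult, EF, EG, !component_dag3, HcF, HcG, Ez
      by (try assumption; now apply Hden).
    reflexivity.
- intros a [Ha Ha'].
  rewrite <- (of_components_component s a Hs) at 1.
  now apply Hind.
Qed.

(** * Assembling the two components *)

(** [l] and [l'] combine to a hyperbolic number, as the hyperbolic numbers are those
    with two real components.  On the filter of invertible increments each component
    tends to its limit without reaching it. *)
Lemma is_BC_FG_derivative_assembled (D D' : C -> Prop) (F G w1 F' G' w2 : C -> C)
  (FF GG w : BC -> BC) (a : BC) (d d' : C) (l m l' m' : R) :
  open (component_domain 1 D D') -> component_domain 1 D D' a ->
  assembles 1 F F' FF -> assembles 1 G G' GG ->
  (forall a, component_domain 1 D D' a ->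
     w a = of_components 1 (w1 (component 1 a)) (w2 (component (- (1)) a))) ->
  let z := component 1 a in let z' := component (- (1)) a in
  w1 z = (RtoC l * F z + RtoC m * G z)%C ->
  filterlim (fun u : C => ((w1 u - RtoC l * F u - RtoC m * G u) / (u - z))%C)
    (locally' z) (locally d) ->
  w2 z' = (RtoC l' * F' z' + RtoC m' * G' z')%C ->
  filterlim (fun u : C => ((w2 u - RtoC l' * F' u - RtoC m' * G' u) / (u - z'))%C)
    (locally' z') (locally d') ->
  is_BC_FG_derivative FF GG w a (of_components 1 d d').
Proof.
intros Ho Ha HFF HGG Hw z z' E Hq E' Hq'.
assert (S1 : sign 1) by now left.
assert (S2 : sign (- (1))) by now apply sign_opp.
assert (Hhyp : forall x y : R, hyperbolic (of_components 1 (RtoC x) (RtoC y))).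
{ intros x y; exists ((x + y) / 2), ((x - y) / 2); C_coordinates. }
exists (of_components 1 (RtoC l) (RtoC l')), (of_components 1 (RtoC m) (RtoC m')).
split; [apply Hhyp|]; split; [apply Hhyp|]; split.
{ rewrite Hw, HFF, HGG by exact Ha; fold z z'.
  apply (component_ext 1); [exact S1 | |];
    rewrite component_plus, !component_mult, ?component_of_components_same,
      ?component_of_components_other by assumption; assumption. }
set (q := fun u : C => ((w1 u - RtoC l * F u - RtoC m * G u) / (u - z))%C) in *.
set (q' := fun u : C => ((w2 u - RtoC l' * F' u - RtoC m' * G' u) / (u - z'))%C) in *.
set (flt := within _ _).
assert (Hflt : Filter flt) by (apply within_filter, locally_filter).
assert (Hcomp : forall s, sign s ->
  filterlim (component s) flt (locally' (component s a))).
{ intros s Hs P HP.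
  assert (H := continuous_component s a _ HP : locally a
    (fun b => component s b <> component s a -> P (component s b))).
  change (locally a (fun b => invertible (b - a)%BC -> P (component s b))).
  revert H; apply filter_imp; intros b Hb Hinv; apply Hb.
  intros Eb; apply (component_invertible s _ Hs Hinv).
  rewrite component_minus, Eb; ring. }
apply (filterlim_ext_loc
  (fun b => of_components 1 (q (component 1 b)) (q' (component (- (1)) b)))).
{ refine (filter_imp _ _ _ (Ho a Ha)); intros b Hb Hinv.
  rewrite (Hw b Hb), HFF, HGG.
  apply (component_ext 1); [exact S1 | |];
    rewrite component_div, !component_minus, !component_mult,
      ?component_of_components_same, ?component_of_components_other by assumption;
    reflexivity. }
apply (filterlim_comp_2 (F := flt) (G := locally d) (H := locally d')
  (fun b => q (component 1 b)) (fun b => q' (component (- (1)) b)) (of_components 1)).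
- exact (filterlim_comp _ _ _ _ _ _ _ _ (Hcomp 1 S1) Hq).
- exact (filterlim_comp _ _ _ _ _ _ _ _ (Hcomp (- (1)) S2) Hq').
- intros P HP.
  destruct (continuous_of_components 1 (d, d') P HP) as [e He].
  apply (Filter_prod _ _ _ (ball d e) (ball d' e)).
  + apply locally_ball.
  + apply locally_ball.
  + intros u v Hu Hv; exact (He (u, v) (conj Hu Hv)).
Qed.

Lemma assembles_combine_e F F' : assembles 1 F F' (combine_e F F').
Proof.
intros a; unfold combine_e; rewrite e1_e2_of_components.
do 2 f_equal; destruct a as [[] []]; C_coordinates.
Qed.

Lemma assembles_swap s F F' FF : assembles s F F' FF -> assembles (- s) F' F FF.
Proof. intros H a; now rewrite of_components_opp, Ropp_involutive. Qed.

Lemma prod_e_component_domain D D' a :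
  prod_e D D' a <-> component_domain 1 D D' a.
Proof.
assert (S1 : sign 1) by now left.
split.
- intros [u [v [Hu [Hv ->]]]]; rewrite e1_e2_of_components; split.
  + now rewrite component_of_components_same.
  + now rewrite component_of_components_other.
- intros [Hu Hv]; exists (component 1 a), (component (- (1)) a).
  now rewrite e1_e2_of_components, of_components_component.
Qed.

Lemma BC_pseudoanalytic_subset (D D' : BC -> Prop) F G w :
  (forall a, D' a -> D a) -> BC_pseudoanalytic D F G w -> BC_pseudoanalytic D' F G w.
Proof.
intros H [H1 H2]; split.
- intros a Ha; apply H1, H, Ha.
- intros k a Ha; apply H2, H, Ha.
Qed.

Theorem theorem11 (D1 D2 : C -> Prop) (F1 G1 F2 G2 : C -> C) (w : BC -> BC)
  (hD1 : open_domain D1) (hD2 : open_domain D2)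
  (hFG1 : generating_pair D1 F1 G1) (hFG2 : generating_pair D2 F2 G2)
  (hw : BC_pseudoanalytic (prod_e D1 D2) (combine_e F1 F2) (combine_e G1 G2) w) :
  exists w1 w2 : C -> C,
    pseudoanalytic D1 F1 G1 w1 /\ pseudoanalytic D2 F2 G2 w2 /\
    (forall z1 z2 : C,
       let a := (BC_of_C z1 + BC_of_C z2 * i2)%BC in
       prod_e D1 D2 a ->
       w a = (BC_of_C (w1 (z1 - z2 * Ci)%C) * e1
              + BC_of_C (w2 (z1 + z2 * Ci)%C) * e2)%BC) /\
    (forall z1 z2 : C,
       let a := (BC_of_C z1 + BC_of_C z2 * i2)%BC in
       prod_e D1 D2 a ->
       exists d1 d2 : C,
         is_FG_derivative F1 G1 w1 (z1 - z2 * Ci)%C d1 /\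
         is_FG_derivative F2 G2 w2 (z1 + z2 * Ci)%C d2 /\
         is_BC_FG_derivative (combine_e F1 F2) (combine_e G1 G2) w a
           (BC_of_C d1 * e1 + BC_of_C d2 * e2)%BC).
Proof.
assert (S1 : sign 1) by now left.
assert (HF := assembles_combine_e F1 F2).
assert (HG := assembles_combine_e G1 G2).
destruct (component_pseudoanalytic D1 D2 F1 G1 F2 G2 _ _ w 1 S1 (proj1 hD1) hD2
  hFG1 hFG2 HF HG) as [w1 [Hw1 E1]].
{ apply (BC_pseudoanalytic_subset (prod_e D1 D2)); [|exact hw].
  intros a; apply prod_e_component_domain. }
destruct (component_pseudoanalytic D2 D1 F2 G2 F1 G1 _ _ w (- (1)) (sign_opp 1 S1)
  (proj1 hD2) hD1 hFG2 hFG1 (assembles_swap _ _ _ _ HF) (assembles_swap _ _ _ _ HG))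
  as [w2 [Hw2 E2]].
{ apply (BC_pseudoanalytic_subset (prod_e D1 D2)); [|exact hw].
  intros a [H2 H1]; rewrite Ropp_involutive in H1.
  now apply prod_e_component_domain. }
assert (E : forall a, component_domain 1 D1 D2 a ->
  w a = of_components 1 (w1 (component 1 a)) (w2 (component (- (1)) a))).
{ intros a Ha; rewrite <- (E1 a Ha), <- (E2 a).
  - symmetry; now apply of_components_component.
  - destruct Ha; split; [easy | now rewrite Ropp_involutive]. }
assert (Ez : forall z1 z2, let a := (BC_of_C z1 + BC_of_C z2 * i2)%BC in
  (z1 - z2 * Ci)%C = component 1 a /\ (z1 + z2 * Ci)%C = component (- (1)) a).
{ intros [] []; split; C_coordinates. }
exists w1, w2; split; [exact Hw1|]; split; [exact Hw2|]; split.
- intros z1 z2 a Ha; apply prod_e_component_domain in Ha.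
  destruct (Ez z1 z2) as [-> ->]; fold a.
  rewrite e1_e2_of_components; now apply E.
- intros z1 z2 a Ha; apply prod_e_component_domain in Ha.
  destruct (Ez z1 z2) as [-> ->]; fold a.
  destruct (generating_pair_span D1 F1 G1 (component 1 a) (w1 (component 1 a)) hFG1
    (proj1 Ha)) as [l [m H1]].
  destruct (generating_pair_span D2 F2 G2 (component (- (1)) a) (w2 (component (- (1)) a))
    hFG2 (proj2 Ha)) as [l' [m' H2]].
  assert (L1 := pseudoanalytic_FG_quotient D1 F1 G1 w1 _ l m (proj1 hD1) hFG1 Hw1
    (proj1 Ha) H1).
  assert (L2 := pseudoanalytic_FG_quotient D2 F2 G2 w2 _ l' m' (proj1 hD2) hFG2 Hw2
    (proj2 Ha) H2).
  eexists; eexists; split; [exists l, m; split; [exact H1 | exact L1]|].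
  split; [exists l', m'; split; [exact H2 | exact L2]|].
  rewrite e1_e2_of_components.
  apply (is_BC_FG_derivative_assembled D1 D2 F1 G1 w1 F2 G2 w2 _ _ w a _ _ l m l' m');
    try assumption.
  apply open_components; [apply hD1 | apply hD2].
Qed.
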